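(* Let $A=\{a_s(n_s)\}_{s=1}^k$ be a finite system of arithmetic sequences ($a_s\in\mathbb{Z}$, $n_s\in\mathbb{Z}^+$), and let $m$ be any integer greater than $k-f([n_1,\ldots,n_k])$. Then there is an $x\in\{0,1,\ldots,|S|-1\}$ such that $w_A(x)\neq m$, where $$S=\bigcup_{s=1}^k\Big\{\frac{r}{n_s}:\ r=0,1,\ldots,n_s-1\Big\}.$$
   Context: $\mathbb{Z}^+=\{1,2,3,\ldots\}$. For $a\in\mathbb{Z}$ and $n\in\mathbb{Z}^+$, $a(n)=\{a+nx:\ x\in\mathbb{Z}\}$. The covering function of $A$ is $w_A(x)=|\{1\le s\le k:\ x\in a_s(n_s)\}|$ for $x\in\mathbb{Z}$. $[n_1,\ldots,n_k]$ is the least common multiple of $n_1,\ldots,n_k$. The function $f$ on $\mathbb{Z}^+$ is given by $f(1)=0$ and $f(\prod_{i=1}^r p_i)=\sum_{i=1}^r(p_i-1)$ where $p_1,\ldots,p_r$ are (not necessarily distinct) primes. The system is nonempty, i.e. $k\ge1$. *)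

(* Defs.v *)
From mathcomp Require Import all_boot all_order all_algebra.
From mathcomp Require Import finmap.

Set Implicit Arguments.
Unset Strict Implicit.
Unset Printing Implicit Defensive.

Import Order.TTheory GRing.Theory Num.Theory.
Local Open Scope ring_scope.

(* The arithmetic sequence a(n) = {a + n x : x in Z}; see arith_seqP. *)
Definition arith_seq (a : int) (n : nat) : {pred int} :=
  [pred x : int | (x == a %[mod n%:Z])%Z].

Lemma arith_seqP (a : int) (n : nat) (x : int) :
  reflect (exists y : int, x = a + n%:Z * y) (x \in arith_seq a n).
Proof.
rewrite inE eqz_mod_dvd; apply: (iffP dvdzP) => [[y xa]|[y ->]].
  by exists y; rewrite mulrC -xa addrC subrK.
by exists y; rewrite addrAC subrr add0r mulrC.
Qed.

Definition covering_fun (k : nat) (a : 'I_k -> int) (n : 'I_k -> nat)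
    (x : int) : nat :=
  #|[set s : 'I_k | x \in arith_seq (a s) (n s)]|.

Definition sys_lcm (k : nat) (n : 'I_k -> nat) : nat :=
  (\big[lcmn/1]_(s < k) n s)%N.

(* Sum of p - 1 over the prime factors p of n, counted with multiplicity;
   see prime_weight1 and prime_weight_prod. *)
Definition prime_weight (n : nat) : nat :=
  (\sum_(pe <- prime_decomp n) pe.2 * (pe.1 - 1))%N.

Lemma prime_weight1 : prime_weight 1 = 0%N.
Proof. by rewrite /prime_weight big_nil. Qed.

Lemma prime_weightE (n b : nat) : (0 < n)%N -> (n < b)%N ->
  prime_weight n = (\sum_(0 <= p < b) logn p n * (p - 1))%N.
Proof.
move=> n0 nb; rewrite /prime_weight prime_decompE big_map /=.
rewrite [RHS](bigID [in primes n]) /= [X in (_ + X)%N]big1 ?addn0; last first.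
  by move=> p; rewrite -logn_gt0 lt0n negbK => /eqP ->.
rewrite -[RHS]big_filter; apply/perm_big/uniq_perm; rewrite ?primes_uniq //.
  exact/filter_uniq/iota_uniq.
move=> p; rewrite mem_filter mem_index_iota /=.
case: (boolP (p \in primes n)) => //; rewrite mem_primes => /and3P[_ _ pn] /=.
by rewrite (leq_ltn_trans _ nb) // dvdn_leq.
Qed.

Lemma prime_weight_prod (s : seq nat) : all prime s ->
  prime_weight (\prod_(p <- s) p) = (\sum_(p <- s) (p - 1))%N.
Proof.
elim: s => [|q s IHs] /=; first by rewrite !big_nil prime_weight1.
case/andP=> pq ps; rewrite !big_cons -{}IHs //.
set t := (\prod_(p <- s) p)%N; have t0 : (0 < t)%N.
  by rewrite /t big_seq prodn_cond_gt0 // => p /(allP ps)/prime_gt0.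
have q0 := prime_gt0 pq.
rewrite !(@prime_weightE _ (q * t).+1) ?muln_gt0 ?q0 ?ltnS ?leq_pmull //.
under eq_bigr => p _ do rewrite lognM // mulnDl.
rewrite big_split /=; congr (_ + _)%N.
rewrite (bigD1_seq q) ?mem_index_iota ?iota_uniq //=; last first.
  by rewrite ltnS leq_pmulr.
rewrite logn_prime // eqxx mul1n big1 ?addn0 // => p /negPf pNq.
by rewrite logn_prime // pNq.
Qed.

Local Open Scope fset_scope.

Definition frac_set (k : nat) (n : 'I_k -> nat) : {fset rat} :=
  \bigcup_(s <- enum 'I_k)
    [fset (r%:R / (n s)%:R : rat) | r : 'I_(n s) in 'I_(n s)].

Lemma frac_setP (k : nat) (n : 'I_k -> nat) (z : rat) :
  reflect (exists s : 'I_k, exists2 r : nat, (r < n s)%N & z = r%:R / (n s)%:R)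
          (z \in frac_set n).
Proof.
rewrite /frac_set; apply: (iffP (bigfcupP _ _ _ _)).
  by case=> s _ /imfsetP[r _ ->]; exists s, r.
case=> s [r rn ->]; exists s; first by rewrite mem_enum.
by apply/imfsetP; exists (Ordinal rn).
Qed.

(* Main.v *)
Require Import Defs.
From mathcomp Require Import all_boot all_order all_algebra.
From mathcomp Require Import finmap.
From mathcomp Require Import all_field zify ring.

(** Two facts combine.

    Local to global.  Let N be the least common multiple of the moduli and z a
    primitive N-th root of unity.  The indicator of a(n) has period n, so, as
    a linear recurrence, it is annihilated by X^n - 1, whose roots are the
    n-th roots of unity z^(N r / n).  Hence every indicator, and every
    constant, is annihilated by the product P of the X - z^j, where j / N runs
    over S, and P has degree |S|.  If the covering function takes the value m
    at 0, ..., |S| - 1, the difference vanishes at deg P consecutive places,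
    therefore everywhere (vanishing_recurrence, multiplicity_local_global).

    Bound.  If the covering function w of a system A of k sequences is constant
    then k >= w + f(N).  Induction forces a statement about functions that are
    only periodic: if w has period D and w(x) > 0, then
      f(lcm(N, D)) + w(x) <= k + f(D)          (multiplicity_bound).
    Choose a prime p dividing N.  Pulling A back along y |-> r + p y keeps the
    sequences with p not dividing n_s, and among the others keeps only those
    with a_s = r mod p, whose moduli get divided by p; call the latter class
    B_r.  The pullback along the residue class of x carries the term w(x) by
    induction.  For every other r with B_r nonempty the induction hypothesis
    is applied to B_r alone: its covering function is the difference of that of
    the whole pullback and that of the sequences with p not dividing n_s, so
    the lcm of their periods is a period; this yields
    |B_r| >= 1 + (its contribution to f).  Submodularity of f on lcm's
    (prime_weight_lcm) adds these contributions up to the weight of a number K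
    with lcm(N, D) dividing p K.  The missing p - 1 = f(p) is either absorbed
    by the period, which becomes D / p when p divides D, or supplied by the
    p - 1 extra units, since if p does not divide D then no B_r is empty
    (ramified_gt0). *)

Set Implicit Arguments.
Unset Strict Implicit.
Unset Printing Implicit Defensive.

Import Order.TTheory GRing.Theory Num.Theory.
Local Open Scope ring_scope.

(** * Prime weights of least common multiples *)

Lemma prime_weightM (b c : nat) : (0 < b)%N -> (0 < c)%N ->
  prime_weight (b * c) = (prime_weight b + prime_weight c)%N.
Proof.
move=> b0 c0; rewrite !(@prime_weightE _ (b * c).+1) ?muln_gt0 ?b0 ?ltnS //;
  rewrite ?leq_pmulr ?leq_pmull //.
by rewrite -big_split; apply: eq_bigr => p _; rewrite lognM // mulnDl.
Qed.

Lemma prime_weight_prime (p : nat) : prime p -> prime_weight p = p.-1.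
Proof.
move=> pp; have := @prime_weight_prod [:: p]; rewrite !big_seq1 /= pp subn1.
exact.
Qed.

Lemma prime_weight_dvd (b c : nat) :
  (0 < c)%N -> (b %| c)%N -> (prime_weight b <= prime_weight c)%N.
Proof.
move=> c0 /dvdnP[d cE]; move: c0; rewrite cE muln_gt0 => /andP[d0 b0].
by rewrite prime_weightM // leq_addl.
Qed.

(** From lcm(X, Y) * gcd(X, Y) = X * Y and additivity: replacing Y by
    lcm(Y, D) leaves lcm(X, Y) unchanged and puts D into the gcd. *)
Lemma prime_weight_lcm (X Y D : nat) : (0 < X)%N -> (0 < Y)%N ->
  (D %| X)%N ->
  (prime_weight (lcmn X Y) + prime_weight D
     <= prime_weight X + prime_weight (lcmn Y D))%N.
Proof.
move=> X0 Y0 DX; have D0 := dvdn_gt0 X0 DX.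
have YD0 : (0 < lcmn Y D)%N by rewrite lcmn_gt0 Y0.
have -> : lcmn X Y = lcmn X (lcmn Y D).
  rewrite [lcmn Y D]lcmnC lcmnA; congr lcmn.
  by apply/eqP; rewrite eqn_dvd dvdn_lcml dvdn_lcm dvdnn.
have XYD0 : (0 < lcmn X (lcmn Y D))%N by rewrite lcmn_gt0 X0.
rewrite -!prime_weightM // prime_weight_dvd ?muln_gt0 ?X0 // -(muln_lcm_gcd X).
by rewrite dvdn_mul // dvdn_gcd DX dvdn_lcmr.
Qed.

Lemma biglcm_gt0 (I : Type) (r : seq I) (P : pred I) (F : I -> nat) :
  (forall i, P i -> (0 < F i)%N) ->
  (0 < \big[lcmn/1]_(i <- r | P i) F i)%N.
Proof.
by move=> F0; elim/big_ind: _ => // x y x0 y0; rewrite lcmn_gt0 x0.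
Qed.

Lemma dvdn_biglcm_seq (I : eqType) (r : seq I) (F : I -> nat) (d : nat) :
  (\big[lcmn/1]_(i <- r) F i %| d)%N = all (fun i => F i %| d)%N r.
Proof.
elim: r => [|i r IHr]; first by rewrite big_nil dvd1n.
by rewrite big_cons dvdn_lcm IHr.
Qed.

(** The contributions e i of the Y i above the common divisor D of X add up;
    the terms D cancel because each Y i is compared with the part D of what has
    been accumulated so far. *)
Lemma prime_weight_biglcm (I : Type) (r : seq I) (P : pred I)
    (Y e : I -> nat) (X D : nat) :
  (0 < X)%N -> (forall i, P i -> (0 < Y i)%N) -> (D %| X)%N ->
  (forall i, P i ->
     prime_weight (lcmn (Y i) D) <= e i + prime_weight D)%N ->
  (prime_weight (lcmn X (\big[lcmn/1]_(i <- r | P i) Y i))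
     <= \sum_(i <- r | P i) e i + prime_weight X)%N.
Proof.
move=> X0 Y0 DX hY; elim: r X X0 DX => [|i r IHr] X X0 DX.
  by rewrite !big_nil lcmn1.
rewrite !big_cons; case: ifPn => Pi; last exact: IHr.
have XY0 : (0 < lcmn X (Y i))%N by rewrite lcmn_gt0 X0 Y0.
have := IHr _ XY0 (dvdn_trans DX (dvdn_lcml _ _)).
have := prime_weight_lcm X0 (Y0 i Pi) DX.
by have := hY i Pi; rewrite lcmnA; lia.
Qed.

(** * Systems of arithmetic sequences and residue classes modulo p *)

Definition multiplicity (A : seq (int * nat)) (x : int) : nat :=
  count (fun s => x \in arith_seq s.1 s.2) A.

Definition lcm_moduli (A : seq (int * nat)) : nat :=
  (\big[lcmn/1]_(s <- A) s.2)%N.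

(** The inverse image of s under y |-> r + p y, which is again an arithmetic
    sequence as soon as it is nonempty (see in_pullback).  If p does not divide
    the modulus, dividing by p is multiplying by a Bezout coefficient. *)
Definition pullback (p r : nat) (s : int * nat) : int * nat :=
  if (p %| s.2)%N then (((s.1 - r%:Z) %/ p%:Z)%Z, s.2 %/ p)%N
  else ((egcdz p s.2).1 * (s.1 - r%:Z), s.2).

Lemma in_arith_seq (a : int) (n : nat) (x : int) :
  (x \in arith_seq a n) = (n%:Z %| x - a)%Z.
Proof. by rewrite inE eqz_mod_dvd. Qed.

Lemma in_pullback (p r : nat) (s : int * nat) (y : int) : prime p ->
  (p %| s.2)%N ==> (p%:Z %| s.1 - r%:Z)%Z ->
  (y \in arith_seq (pullback p r s).1 (pullback p r s).2) =
  (r%:Z + p%:Z * y \in arith_seq s.1 s.2).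
Proof.
case: s => a n pp /=; rewrite /pullback !in_arith_seq /=.
have p0 : p%:Z != 0 by rewrite eqz_nat -lt0n prime_gt0.
case: ifPn => /= pn.
  move=> pa; rewrite -(dvdz_mul2l p0) -PoszM mulnC divnK //.
  congr (_ %| _)%Z; have := divzK pa; lia.
move=> _; case: egcdzP => u v uv _ /=.
have cop : coprimez n p by rewrite coprimezE coprime_sym prime_coprime.
rewrite -(Gauss_dvdzr (n := p%:Z) _ cop).
(* Multiplying the pulled-back condition by p gives the original one up to a
   multiple of n, as u p = 1 modulo n. *)
have cE : p%:Z * (y - u * (a - r%:Z)) =
    (r%:Z + p%:Z * y - a) + (a - r%:Z) * v * n%:Z.
  rewrite -mulrA; have -> : v * n%:Z = 1 - u * p%:Z.
    by rewrite -(eqP cop) gcdzC -uv; ring.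
  by ring.
by rewrite cE rpredDr // dvdz_mull.
Qed.

Definition periodic (u : int -> nat) (D : nat) : Prop :=
  forall x y : int, (D%:Z %| x - y)%Z -> u x = u y.

Lemma dvdn_lcm_moduli (A : seq (int * nat)) (s : int * nat) :
  s \in A -> (s.2 %| lcm_moduli A)%N.
Proof.
have /allP sL := etrans (esym (dvdn_biglcm_seq A snd _)) (dvdnn (lcm_moduli A)).
exact: sL.
Qed.

Lemma multiplicity_periodic (A : seq (int * nat)) :
  periodic (multiplicity A) (lcm_moduli A).
Proof.
move=> x y xy; apply: eq_in_count => s sA.
have sL := dvdn_lcm_moduli sA.
rewrite !in_arith_seq; have -> : x - s.1 = (x - y) + (y - s.1) by ring.
by rewrite rpredDl // (dvdz_trans _ xy).
Qed.

(** A sequence whose modulus is prime to p meets every residue class modulo p;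
    one whose modulus is divisible by p lies in a single class r. *)
Definition unramified (p : nat) (A : seq (int * nat)) : seq (int * nat) :=
  [seq s <- A | ~~ (p %| s.2)%N].

Definition ramified (p r : nat) (A : seq (int * nat)) : seq (int * nat) :=
  [seq s <- A | (p %| s.2)%N && (p%:Z %| s.1 - r%:Z)%Z].

Lemma multiplicity_pullback (p r : nat) (A : seq (int * nat)) (y : int) :
  prime p ->
  multiplicity [seq pullback p r s | s <- unramified p A ++ ramified p r A] y
    = multiplicity A (r%:Z + p%:Z * y).
Proof.
move=> pp; rewrite map_cat /multiplicity count_cat.
elim: A => //= s A IHA; have [pn|pn] := boolP (p %| s.2)%N => /=.
  case: ifPn => pa /=; first by rewrite in_pullback ?pn // addnCA IHA.
  rewrite IHA; case: (boolP (_ \in _)) => // /[!in_arith_seq] cov.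
  case/negP: pa; have pcov : (p%:Z %| r%:Z + p%:Z * y - s.1)%Z.
    by apply: dvdz_trans cov.
  have -> : s.1 - r%:Z = p%:Z * y - (r%:Z + p%:Z * y - s.1) by ring.
  by rewrite rpredB // dvdz_mulr.
by rewrite in_pullback ?(negPf pn) // -addnA IHA.
Qed.

Lemma periodic_affine (u : int -> nat) (r p D E : nat) : (D %| p * E)%N ->
  periodic u D -> periodic (fun y => u (r%:Z + p%:Z * y)) E.
Proof.
move=> DE uD x y xy; apply: uD.
have -> : r%:Z + p%:Z * x - (r%:Z + p%:Z * y) = p%:Z * (x - y) by ring.
by apply: dvdz_trans (dvdz_mul (dvdzz p) xy); rewrite -PoszM.
Qed.

Lemma size_ramified (p : nat) (A : seq (int * nat)) : (0 < p)%N ->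
  size A = (size (unramified p A) + \sum_(r < p) size (ramified p r A))%N.
Proof.
move=> p0; elim: A => [|s A IHA] /=; first by rewrite big1.
have [pn|pn] /= := boolP (p %| s.2)%N; last by rewrite IHA.
have pz : p%:Z != 0 by rewrite eqz_nat -lt0n.
pose c := `|(s.1 %% p%:Z)%Z|%N.
have cE : c%:Z = (s.1 %% p%:Z)%Z by rewrite gez0_abs // modz_ge0.
have cp : (c < p)%N by rewrite -ltz_nat cE ltz_pmod.
rewrite IHA addnC -addSn addnC; congr (_ + _)%N.
rewrite (bigD1 (Ordinal cp)) // [RHS](bigD1 (Ordinal cp)) //=.
have -> : (p%:Z %| s.1 - c%:Z)%Z by rewrite cE -eqz_mod_dvd modz_mod.
rewrite /= addSn; congr (_ + _).+1; apply: eq_bigr => r rc.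
case: ifP => //; rewrite -eqz_mod_dvd => /eqP sr; case/eqP: rc.
apply: val_inj => /=; apply/eqP; rewrite -eqz_nat cE sr modz_small //.
by rewrite ltz_nat ltn_ord.
Qed.

Lemma prime_dvd_lcm (p b c : nat) : prime p ->
  (p %| lcmn b c)%N = (p %| b)%N || (p %| c)%N.
Proof.
move=> pp; apply/idP/orP => [pbc|[] pb]; last 2 first.
- exact: dvdn_trans (dvdn_lcml _ _).
- exact: dvdn_trans (dvdn_lcmr _ _).
apply/orP; rewrite -Euclid_dvdM // (dvdn_trans pbc) //.
by rewrite dvdn_lcm dvdn_mulr ?dvdn_mull.
Qed.

Lemma prime_dvd_lcm_moduli (p : nat) (A : seq (int * nat)) : prime p ->
  (p %| lcm_moduli A)%N = has (fun s => p %| s.2)%N A.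
Proof.
move=> pp; rewrite /lcm_moduli; elim: A => [|s A IHA].
  by rewrite big_nil dvdn1; case: eqP pp => // ->.
by rewrite big_cons prime_dvd_lcm // IHA.
Qed.

Lemma lcm_moduli_gt0 (A : seq (int * nat)) :
  all (fun s => 0 < s.2)%N A -> (0 < lcm_moduli A)%N.
Proof.
by rewrite /lcm_moduli => /allP A0; rewrite big_seq; apply: biglcm_gt0.
Qed.

Lemma multiplicity_filter (A : seq (int * nat)) (P : pred (int * nat)) x :
  multiplicity A x = (multiplicity [seq s <- A | ~~ P s] x
                      + multiplicity [seq s <- A | P s] x)%N.
Proof.
rewrite addnC -count_cat; apply/permP.
by rewrite perm_sym; apply/permPl; apply: perm_filterC.
Qed.

(** Used to peel off the sequences unramified at p: the covering function of
    the remaining ones inherits a period not involving their own moduli. *)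
Lemma periodic_addl (u v w : int -> nat) (D E : nat) :
  (forall x, w x = u x + v x)%N -> periodic w D -> periodic u E ->
  periodic v (lcmn D E).
Proof.
move=> wE wD uE x y xy; apply/eqP; rewrite -(eqn_add2l (u x)) -wE.
rewrite (wD x y) ?(uE x y) ?wE //; apply: dvdz_trans xy.
  exact: dvdn_lcmr.
exact: dvdn_lcml.
Qed.

(** The covering function of all ramified sequences has a period E prime to p,
    so a point covered by one of them can be moved by multiples of E into any
    residue class modulo p and stays covered. *)
Lemma ramified_gt0 (p r D : nat) (A : seq (int * nat)) : prime p ->
  ~~ (p %| D)%N -> periodic (multiplicity A) D -> (p %| lcm_moduli A)%N ->
  (0 < size (ramified p r A))%N.
Proof.
move=> pp pD Aper; rewrite prime_dvd_lcm_moduli // => /hasP[s sA ps].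
set E := lcmn D (lcm_moduli (unramified p A)).
have pE : coprimez E p.
  rewrite coprimezE coprime_sym prime_coprime // prime_dvd_lcm // negb_or pD.
  rewrite prime_dvd_lcm_moduli //; apply/hasPn => t.
  by rewrite mem_filter => /andP[].
have Bper := periodic_addl (multiplicity_filter A (fun s => p %| s.2)%N) Aper
  (@multiplicity_periodic (unramified p A)).
case: (egcdzP E p) => u v uv _; rewrite (eqP pE) in uv.
(* u inverts E modulo p, so x = r modulo p and x = s.1 modulo E. *)
pose x := s.1 + E%:Z * (u * (r%:Z - s.1)).
have : (0 < multiplicity [seq s <- A | p %| s.2] x)%N.
  rewrite (Bper x s.1) /x.
    rewrite -has_count; apply/hasP; exists s; first by rewrite mem_filter ps.
    by rewrite /= in_arith_seq subrr dvdz0.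
  by rewrite addrC addKr dvdz_mulr.
rewrite -has_count => /hasP[t]; rewrite mem_filter in_arith_seq.
case/andP=> pt tA tx; rewrite -has_predT; apply/hasP; exists t => //.
rewrite mem_filter pt tA andbT /=.
have xr : x - r%:Z = (s.1 - r%:Z) * v * p%:Z.
  rewrite -mulrA; have -> : v * p%:Z = 1 - u * E%:Z by rewrite -uv; ring.
  by rewrite /x; ring.
have -> : t.1 - r%:Z = (x - r%:Z) - (x - t.1) by ring.
rewrite rpredB // ?xr ?dvdz_mull //.
by apply: dvdz_trans tx.
Qed.

Lemma lcm_moduli_pullback_dvd (p r K : nat) (A : seq (int * nat)) : prime p ->
  (lcm_moduli A %| p * K)%N ->
  (lcm_moduli [seq pullback p r s | s <- A] %| K)%N.
Proof.
move=> pp; rewrite /lcm_moduli !dvdn_biglcm_seq all_map => /allP AK.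
apply/allP => s /AK /=; rewrite /pullback; case: ifPn => ps sK /=.
  by rewrite -(dvdn_pmul2l (prime_gt0 pp)) mulnC divnK.
by rewrite -(Gauss_dvdr _ (_ : coprime s.2 p)) // coprime_sym prime_coprime.
Qed.

Lemma dvd_lcm_moduli_pullback (p r K : nat) (A : seq (int * nat)) :
  (lcm_moduli [seq pullback p r s | s <- A] %| K)%N ->
  (lcm_moduli A %| p * K)%N.
Proof.
rewrite /lcm_moduli !dvdn_biglcm_seq all_map => /allP AK.
apply/allP => s /AK /=; rewrite /pullback; case: ifPn => ps sK /=.
  by rewrite -(divnK ps) mulnC dvdn_mul.
by rewrite dvdn_mull.
Qed.

Lemma pullback_gt0 (p r : nat) (A : seq (int * nat)) : prime p ->
  all (fun s => 0 < s.2)%N A ->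
  all (fun s => 0 < s.2)%N [seq pullback p r s | s <- A].
Proof.
move=> pp /allP A0; rewrite all_map; apply/allP => s /A0 /=.
rewrite /pullback; case: ifP => //= ps s0.
by rewrite divn_gt0 ?prime_gt0 // dvdn_leq.
Qed.

Lemma lcm_moduli_pullback_unramified (p r : nat) (A : seq (int * nat)) :
  lcm_moduli [seq pullback p r s | s <- unramified p A] =
  lcm_moduli (unramified p A).
Proof.
rewrite /lcm_moduli big_map big_filter [RHS]big_filter.
by apply: eq_bigr => s ps; rewrite /pullback (negPf ps).
Qed.

Lemma lcm_moduli_cat (A B : seq (int * nat)) :
  lcm_moduli (A ++ B) = lcmn (lcm_moduli A) (lcm_moduli B).
Proof. exact: big_cat. Qed.

(** * The lower bound for the number of sequences *)

(** Allowing an arbitrary period D, instead of constant multiplicity, is what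
    lets the induction treat the ramified sequences of one residue class by
    themselves.  Induction on the lcm of the moduli, which loses a factor p
    under restriction to a residue class modulo p. *)
Lemma multiplicity_bound (A : seq (int * nat)) (D : nat) (x : int) :
  all (fun s => 0 < s.2)%N A -> (0 < D)%N -> periodic (multiplicity A) D ->
  (0 < multiplicity A x)%N ->
  (prime_weight (lcmn (lcm_moduli A) D) + multiplicity A x
     <= size A + prime_weight D)%N.
Proof.
have [N] := ubnP (lcm_moduli A); elim: N A D x => // N IHN A D x.
rewrite ltnS => LAN A0 D0 Aper Ax; have LA0 := lcm_moduli_gt0 A0.
have [->|LA1] := eqVneq (lcm_moduli A) 1%N.
  rewrite (_ : lcmn 1 D = D) 1?addnC ?leq_add2r ?count_size //.
  by rewrite -{2}(lcm1n D).
pose p := pdiv (lcm_moduli A).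
have pp : prime p by rewrite pdiv_prime // ltn_neqAle eq_sym LA1.
have p0 := prime_gt0 pp; have p1 := prime_gt1 pp.
have pLA : (p %| lcm_moduli A)%N := pdiv_dvd _.
(* D1 is the period after restriction to a residue class modulo p. *)
pose D1 := if (p %| D)%N then (D %/ p)%N else D.
have DD1 : (D %| p * D1)%N.
  rewrite /D1; case: ifP => [pD|_]; last exact: dvdn_mull.
  by rewrite mulnC divnK.
have D10 : (0 < D1)%N.
  by rewrite /D1; case: ifP => // pD; rewrite divn_gt0 // dvdn_leq.
pose C := unramified p A.
pose C' (r : nat) := [seq pullback p r s | s <- C].
pose B' (r : nat) := [seq pullback p r s | s <- ramified p r A].
pose A' (r : nat) := C' r ++ B' r.
have CL r : lcm_moduli (C' r) = lcm_moduli C.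
  exact: lcm_moduli_pullback_unramified.
(* D2 is a period of each covering function of B' r. *)
pose D2 := lcmn D1 (lcm_moduli C).
have C0 : all (fun s => 0 < s.2)%N C.
  by apply/allP => s; rewrite mem_filter => /andP[_ /(allP A0)].
have B0 r : all (fun s => 0 < s.2)%N (B' r).
  apply: pullback_gt0 => //.
  by apply/allP => s; rewrite mem_filter => /andP[_ /(allP A0)].
have A'0 r : all (fun s => 0 < s.2)%N (A' r).
  by rewrite all_cat B0 pullback_gt0.
have A'E r y : multiplicity (A' r) y = multiplicity A (r%:Z + p%:Z * y).
  by rewrite /A' -map_cat multiplicity_pullback.
have A'per r : periodic (multiplicity (A' r)) D1.
  move=> y z yz; rewrite !A'E.
  exact: (periodic_affine (u := multiplicity A) r DD1).
have D20 : (0 < D2)%N by rewrite lcmn_gt0 D10 lcm_moduli_gt0.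
have LA'N r : (lcm_moduli (A' r) < N)%N.
  have LK : (lcm_moduli A %/ p < lcm_moduli A)%N by rewrite ltn_Pdiv.
  apply: leq_trans LAN; apply: leq_ltn_trans LK; apply: dvdn_leq.
    by rewrite divn_gt0 // dvdn_leq.
  rewrite /A' -map_cat; apply: lcm_moduli_pullback_dvd => //.
  rewrite mulnC divnK // /lcm_moduli dvdn_biglcm_seq.
  apply/allP => s; rewrite mem_cat !mem_filter.
  by case/orP=> /andP[_ /dvdn_lcm_moduli].
have LB'N r : (lcm_moduli (B' r) < N)%N.
  apply: leq_ltn_trans (LA'N r); rewrite dvdn_leq ?lcm_moduli_gt0 //.
  by rewrite lcm_moduli_cat dvdn_lcmr.
have B'per r : periodic (multiplicity (B' r)) D2.
  rewrite /D2 -(CL r); apply: periodic_addl (@multiplicity_periodic (C' r)).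
    by move=> y; apply: count_cat.
  exact: A'per.
(* r0 is the residue of x, whose class keeps the term multiplicity A x. *)
pose r0 := `|(x %% p%:Z)%Z|%N.
have pz : p%:Z != 0 by rewrite eqz_nat -lt0n.
have r0E : r0%:Z = (x %% p%:Z)%Z by rewrite gez0_abs // modz_ge0.
have r0p : (r0 < p)%N by rewrite -ltz_nat r0E ltz_pmod.
have xE : multiplicity (A' r0) (x %/ p%:Z)%Z = multiplicity A x.
  by rewrite A'E r0E addrC mulrC -divz_eq.
have IH0 := IHN (A' r0) D1 (x %/ p%:Z)%Z (LA'N r0) (A'0 r0) D10 (A'per r0).
rewrite xE in IH0; have {}IH0 := IH0 Ax.
(* The predecessor accounts for the unit gained from a covered point of a
   nonempty B' r; truncation gives 0 for the empty one, which contributes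
   nothing. *)
have IHB r : (prime_weight (lcmn (lcm_moduli (B' r)) D2)
               <= (size (B' r)).-1 + prime_weight D2)%N.
  have [->|] := eqVneq (B' r) [::].
    by rewrite /lcm_moduli big_nil (_ : lcmn 1 D2 = D2) // -{2}(lcm1n D2).
  case BrE: (B' r) => [//|t B] _; rewrite -BrE.
  have Bt : (0 < multiplicity (B' r) t.1)%N.
    rewrite -has_count; apply/hasP; exists t; first by rewrite BrE mem_head.
    by rewrite /= in_arith_seq subrr dvdz0.
  have := IHN (B' r) D2 t.1 (LB'N r) (B0 r) D20 (B'per r) Bt.
  by move: Bt; rewrite BrE /=; lia.
pose X := lcmn (lcm_moduli (A' r0)) D1.
have X0 : (0 < X)%N by rewrite lcmn_gt0 lcm_moduli_gt0.
have D2X : (D2 %| X)%N.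
  rewrite /D2 /X dvdn_lcm dvdn_lcmr (dvdn_trans _ (dvdn_lcml _ _)) //.
  by rewrite lcm_moduli_cat CL dvdn_lcml.
(* p * K is a common multiple of D and of all moduli. *)
pose K := lcmn X (\big[lcmn/1]_(r < p | r != Ordinal r0p) lcm_moduli (B' r)).
pose SB := (\sum_(r < p | r != Ordinal r0p) (size (B' r)).-1)%N.
pose SR := (\sum_(r < p | r != Ordinal r0p) size (ramified p r A))%N.
have KE : (prime_weight K <= SB + prime_weight X)%N.
  apply: prime_weight_biglcm D2X _ => // r _.
  exact: lcm_moduli_gt0.
have K0 : (0 < K)%N.
  rewrite lcmn_gt0 X0; apply: biglcm_gt0 => r _; exact: lcm_moduli_gt0.
have XK : (X %| K)%N := dvdn_lcml _ _.
have CK : (lcm_moduli C %| p * K)%N.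
  by rewrite dvdn_mull // (dvdn_trans (dvdn_lcmr D1 _)) // (dvdn_trans D2X).
have BK (r : 'I_p) : (lcm_moduli (ramified p r A) %| p * K)%N.
  apply: (@dvd_lcm_moduli_pullback p r); rewrite -/(B' r).
  have [rr0|rr0] := eqVneq r (Ordinal r0p).
    rewrite (dvdn_trans _ XK) // (dvdn_trans _ (dvdn_lcml _ _)) //.
    by rewrite rr0 lcm_moduli_cat dvdn_lcmr.
  rewrite (dvdn_trans _ (dvdn_lcmr _ _)) // (bigD1 r) //=.
  exact: dvdn_lcml.
have LK : (lcmn (lcm_moduli A) D %| p * K)%N.
  rewrite dvdn_lcm (dvdn_trans DD1) ?andbT; last first.
    by rewrite dvdn_mul // (dvdn_trans _ XK) // dvdn_lcmr.
  rewrite /lcm_moduli dvdn_biglcm_seq; apply/allP => s sA.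
  have [ps|ps] := boolP (p %| s.2)%N; last first.
    move: CK; rewrite /lcm_moduli dvdn_biglcm_seq => /allP; apply.
    by rewrite mem_filter ps.
  pose c := `|(s.1 %% p%:Z)%Z|%N.
  have cE : c%:Z = (s.1 %% p%:Z)%Z by rewrite gez0_abs // modz_ge0.
  have cp : (c < p)%N by rewrite -ltz_nat cE ltz_pmod.
  have := BK (Ordinal cp); rewrite /lcm_moduli dvdn_biglcm_seq => /allP; apply.
  by rewrite mem_filter ps sA cE -eqz_mod_dvd modz_mod eqxx.
have sB r : size (B' r) = size (ramified p r A) by rewrite size_map.
have := size_ramified A p0; rewrite -/C (bigD1 (Ordinal r0p)) //= -/SR => sA.
have := prime_weight_dvd (_ : 0 < p * K)%N LK; rewrite muln_gt0 p0 K0.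
rewrite prime_weightM // (prime_weight_prime pp) => /(_ isT) fLK.
rewrite size_cat !size_map in IH0.
(* The term p.-1 is paid by the change of period from D to D1 if p %| D, and
   otherwise by the units lost in the predecessors, no class being empty. *)
have sum_le : (p.-1 + SB + prime_weight D1 <= SR + prime_weight D)%N.
  rewrite /D1 /SB /SR; under eq_bigr do rewrite sB; case: ifPn => pD.
    have {2}-> : D = (p * (D %/ p))%N by rewrite mulnC divnK.
    rewrite prime_weightM ?divn_gt0 ?(dvdn_leq _ pD) //.
    rewrite (prime_weight_prime pp).
    rewrite addnAC addnA addnAC leq_add2r addnC leq_add2r.
    by apply: leq_sum => r _; apply: leq_pred.
  rewrite leq_add2r -[X in (X.-1)%N](card_ord p) -(cardC1 (Ordinal r0p)).
  rewrite -sum1_card -big_split leq_sum //= => r _.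
  by rewrite add1n prednK // (ramified_gt0 _ pp pD Aper).
rewrite -/X in IH0; move: sA IH0 fLK KE sum_le; clearbody SB SR; clear.
by lia.
Qed.

(** * From finitely many values to all values *)

(** The linear form on polynomials sending X^i to u i; that u satisfies the
    linear recurrence with characteristic polynomial P means that this form
    kills all multiples of P. *)
Definition eval_form (R : nzRingType) (u : nat -> R) (p : {poly R}) : R :=
  \sum_(i < size p) p`_i * u i.

Lemma eval_form_widen (R : nzRingType) (u : nat -> R) (p : {poly R}) (M : nat) :
  (size p <= M)%N -> eval_form u p = \sum_(i < M) p`_i * u i.
Proof.
move=> pM; rewrite /eval_form (big_ord_widen _ (fun i => p`_i * u i) pM).
rewrite big_mkcond; apply: eq_bigr => i _; case: ltnP => // pi.
by rewrite nth_default // mul0r.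
Qed.

Lemma eval_formD (R : nzRingType) (u : nat -> R) (p q : {poly R}) :
  eval_form u (p + q) = eval_form u p + eval_form u q.
Proof.
pose M := maxn (size p) (size q).
rewrite (@eval_form_widen _ u p M) ?leq_maxl //.
rewrite (@eval_form_widen _ u q M) ?leq_maxr //.
rewrite (@eval_form_widen _ u _ M) ?size_polyD // -big_split.
by apply: eq_bigr => i _; rewrite coefD mulrDl.
Qed.

Lemma eval_formXn (R : nzRingType) (u : nat -> R) (x : nat) :
  eval_form u 'X^x = u x.
Proof.
rewrite /eval_form size_polyXn big_ord_recr /= coefXn eqxx mul1r.
rewrite big1 ?add0r // => i _; rewrite coefXn ltn_eqF ?mul0r //.
Qed.

Lemma eval_form_periodic (R : nzRingType) (u : nat -> R) (n : nat)
    (q : {poly R}) :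
  (forall i, u (n + i)%N = u i) -> eval_form u (q * ('X^n - 1)) = 0.
Proof.
move=> un; apply: (@addIr _ (eval_form u q)); rewrite add0r -eval_formD.
rewrite mulrBr mulr1 subrK (@eval_form_widen _ _ _ (n + size q)).
  rewrite big_split_ord /= big1 ?add0r => [|i _]; last first.
    by rewrite coefMXn ltn_ord mul0r.
  apply: eq_bigr => i _; rewrite coefMXn ltnNge leq_addr /= addKn.
  by rewrite un.
by rewrite (leq_trans (size_polyMleq _ _)) // size_polyXn addnS addnC.
Qed.

(** u x is the value of the form at X^x, which depends only on the remainder
    of X^x modulo P, a combination of the X^i with i < deg P. *)
Lemma vanishing_recurrence (F : fieldType) (u : nat -> F) (P : {poly F}) :
  P != 0 -> (forall q, eval_form u (q * P) = 0) ->
  (forall i, (i < (size P).-1)%N -> u i = 0) -> forall x, u x = 0.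
Proof.
move=> P0 Pu u0 x; rewrite -eval_formXn (divp_eq 'X^x P) eval_formD Pu add0r.
rewrite /eval_form big1 // => i _; rewrite u0 ?mulr0 //.
apply: leq_trans (ltn_ord i) _.
by rewrite -ltnS prednK ?lt0n ?size_poly_eq0 ?ltn_modpN0.
Qed.

(** The numerators j of the fractions j / N in S, for N the lcm of the moduli
    (see size_frequencies). *)
Definition frequencies (A : seq (int * nat)) : seq nat :=
  let N := lcm_moduli A in
  [seq j <- iota 0 N | has (fun s => N %/ s.2 %| j)%N A].

Lemma multiplicity_local_global (A : seq (int * nat)) (m : nat) :
  all (fun s => 0 < s.2)%N A -> (0 < size A)%N ->
  (forall x : nat, (x < size (frequencies A))%N -> multiplicity A x = m) ->
  forall x, multiplicity A x = m.
Proof.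
move=> A0 sA Am; have N0 := lcm_moduli_gt0 A0; set N := lcm_moduli A in N0.
(* By periodicity it is enough to treat nonnegative x. *)
suff Anat (x : nat) : multiplicity A x = m.
  move=> x; have <- := Anat `|(x + N%:Z * `|x|)%R|%N.
  apply: (@multiplicity_periodic A); rewrite gez0_abs; last by nia.
  by rewrite opprD addNKr -mulrN dvdz_mulr.
have [z zN] := C_prim_root_exists N0.
pose T := [seq z ^+ j | j <- frequencies A].
pose P := \prod_(c <- T) ('X - c%:P).
have sP : (size P).-1 = size (frequencies A).
  by rewrite size_prod_XsubC size_map.
have P0 : P != 0 by rewrite -size_poly_eq0 size_prod_XsubC.
(* The s.2-th roots of unity are the powers of z ^+ (N / s.2), roots of P. *)
have dP s : s \in A -> exists Q, P = Q * ('X^(s.2) - 1).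
  move=> sInA; have s0 := allP A0 _ sInA; have sN := dvdn_lcm_moduli sInA.
  have NE : (N = N %/ s.2 * s.2)%N by rewrite divnK.
  have zs : s.2.-primitive_root (z ^+ (N %/ s.2)).
    exact: dvdn_prim_root.
  apply/dvdpP; rewrite -(factor_Xn_sub_1 zs).
  rewrite -(big_map _ xpredT (fun c => 'X - c%:P)).
  apply: uniq_roots_dvdp.
    apply/allP => _ /mapP[i + ->]; rewrite mem_index_iota => /= i_s.
    rewrite root_prod_XsubC -exprM; apply: map_f.
    rewrite mem_filter mem_iota /= add0n [X in (_ < X)%N]NE.
    rewrite ltn_pmul2l ?i_s ?andbT.
      by apply/hasP; exists s => //; rewrite dvdn_mulr.
    by rewrite divn_gt0 // dvdn_leq.
  rewrite uniq_rootsE map_inj_in_uniq ?iota_uniq // => i j.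
  rewrite !mem_index_iota /= => i_s j_s /eqP.
  by rewrite (eq_prim_root_expr zs) !modn_small // => /eqP.
pose u (x : nat) : algC := (multiplicity A x)%:R - m%:R.
have killP (v : nat -> algC) s : s \in A ->
    (forall i, v (s.2 + i)%N = v i) -> forall q, eval_form v (q * P) = 0.
  by move=> /dP[Q ->] vs q; rewrite mulrA eval_form_periodic.
have uE (q : {poly algC}) : eval_form u q = \sum_(s <- A)
    eval_form (fun i : nat => (i%:Z \in arith_seq s.1 s.2)%:R) q
    - eval_form (fun=> m%:R) q.
  rewrite /eval_form exchange_big -sumrB; apply: eq_bigr => i _ /=.
  rewrite -mulr_sumr -mulrBr /u; congr (_ * (_ - _)).
  rewrite /multiplicity -sum1_count big_mkcond natr_sum.
  by apply: eq_bigr => s _; case: ifP.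
have kill_u q : eval_form u (q * P) = 0.
  rewrite uE big_seq big1 ?sub0r => [|s sInA]; last first.
    apply: (killP _ s) => // i; rewrite !in_arith_seq PoszD -addrA.
    by rewrite rpredDl.
  (* A constant has the period of any member of A. *)
  have /hasP[s sInA _] : has predT A by rewrite has_predT.
  by rewrite (killP _ s) ?oppr0.
have u0 i : (i < (size P).-1)%N -> u i = 0.
  by rewrite sP => iT; rewrite /u Am // subrr.
move: (vanishing_recurrence P0 kill_u u0 x) => /eqP.
by rewrite subr_eq0 eqr_nat => /eqP.
Qed.

Lemma size_frequencies (k : nat) (a : 'I_k -> int) (n : 'I_k -> nat) :
  (forall s, 0 < n s)%N ->
  (size (frequencies [seq (a s, n s) | s <- enum 'I_k]) <= #|` frac_set n|)%N.
Proof.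
move=> n0; set A := [seq _ | _ <- _].
have A0 : all (fun s => 0 < s.2)%N A by rewrite all_map; apply/allP => s _ /=.
have N0 := lcm_moduli_gt0 A0; set N := lcm_moduli A in N0.
have NQ : N%:R != 0 :> rat by rewrite pnatr_eq0 -lt0n.
rewrite -(size_map (fun j => j%:R / N%:R : rat)); apply: uniq_leq_size.
  rewrite map_inj_uniq ?filter_uniq ?iota_uniq // => i j /(divIf NQ) /eqP.
  by rewrite eqr_nat => /eqP.
move=> _ /mapP[j + ->]; rewrite mem_filter mem_iota add0n => /andP[+ jN].
case/hasP=> _ /mapP[s _ ->] /= ej; apply/frac_setP; exists s.
have sN : (n s %| N)%N.
  by apply: (@dvdn_lcm_moduli A (a s, n s)); rewrite map_f ?mem_enum.
have NE : (N = N %/ n s * n s)%N by rewrite divnK.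
have e0 : (0 < N %/ n s)%N by rewrite divn_gt0 // dvdn_leq.
rewrite -/N in ej; exists (j %/ (N %/ n s))%N.
  by rewrite ltn_divLR // mulnC -NE.
apply/eqP; rewrite eqr_div ?pnatr_eq0 -?lt0n // -!natrM eqr_nat {2}NE.
by rewrite mulnA divnK.
Qed.

Theorem corollary1p2 (k : nat) (a : 'I_k -> int) (n : 'I_k -> nat) (m : int)
    (k_gt0 : (0 < k)%N)
    (n_gt0 : forall s : 'I_k, (0 < n s)%N)
    (m_gt : k%:Z - (prime_weight (sys_lcm n))%:Z < m) :
  exists x : nat,
    (x < #|` frac_set n|)%N /\ (covering_fun a n x%:Z)%:Z <> m.
Proof.
pose A := [seq (a s, n s) | s <- enum 'I_k].
have sA : size A = k by rewrite size_map size_enum_ord.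
have A0 : all (fun s => 0 < s.2)%N A by rewrite all_map; apply/allP => s _ /=.
have LA : lcm_moduli A = sys_lcm n by rewrite /lcm_moduli big_map big_enum.
have AE x : multiplicity A x = covering_fun a n x.
  rewrite /multiplicity count_map /covering_fun cardsE cardE size_filter.
  by rewrite -enumT; apply: eq_count.
have [/existsP[x xm]|] := boolP [exists x : 'I_(#|` frac_set n|),
    (covering_fun a n x%:Z)%:Z != m].
  by exists x; split=> //; apply/eqP.
rewrite negb_exists => /forallP Am; exfalso.
have S0 : (0 < #|` frac_set n|)%N.
  rewrite cardfs_gt0; apply/fset0Pn; exists 0; apply/frac_setP.
  by exists (Ordinal k_gt0); exists 0%N; rewrite ?mul0r.
have mE : (multiplicity A 0)%:Z = m.
  by have := Am (Ordinal S0); rewrite negbK -AE => /eqP.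
have Aconst x : multiplicity A x = multiplicity A 0.
  apply: multiplicity_local_global; rewrite ?sA // => y yT.
  have yS := leq_trans yT (size_frequencies a n_gt0).
  have := Am (Ordinal yS); rewrite negbK -AE /= -mE => /eqP.
  by case.
have Am0 : (0 < multiplicity A (a (Ordinal k_gt0)))%N.
  rewrite -has_count; apply/hasP; exists (a (Ordinal k_gt0), n (Ordinal k_gt0)).
    by apply: map_f; rewrite mem_enum.
  by rewrite /= in_arith_seq subrr dvdz0.
(* Constant multiplicity is the case of period 1, and f(1) = 0. *)
have Aper : periodic (multiplicity A) 1 by move=> x y _; rewrite !Aconst.
have := multiplicity_bound A0 (ltn0Sn 0) Aper Am0.
by rewrite Aconst LA sA lcmn1 prime_weight1; lia.
Qed.
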